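(* $\forall x\, F\rightarrow$ has an extended Herbrand-sequent $H$ with $|H| = l$ iff there is a totally rigid acyclic tree grammar $G$ with $|G|=l$ such that $\bigwedge_{t\in L(G)} F\{x\mapsto t\}\rightarrow$ is a tautology.
   Context: Fix a quantifier-free formula $F$ with one free variable $x$ such that $\forall x\, F$ is unsatisfiable; $A\{x\mapsto t\}$ denotes substitution of $t$ for $x$ in $A$, and $\Var(t)$ is the set of variables of $t$. An extended Herbrand-sequent of $\forall x\, F\rightarrow$ is a tautological sequent $H = F\{x\mapsto u_1\},\ldots,F\{x\mapsto u_m\}, A_1\supset\bigwedge_{j=1}^{k_1}A_1\{\alpha_1\mapsto s_{1,j}\},\ldots,A_n\supset\bigwedge_{j=1}^{k_n}A_n\{\alpha_n\mapsto s_{n,j}\}\rightarrow$ with $A_i$ quantifier-free, $\Var(A_i)\subseteq\{\alpha_i,\ldots,\alpha_n\}$, $\Var(s_{i,j})\subseteq\{\alpha_{i+1},\ldots,\alpha_n\}$; $|H|=m+\sum_i k_i$. A totally rigid tree grammar $\langle N,\Sigma,\tau,P\rangle$ is a regular tree grammar (non-terminals $N$, signature $\Sigma$, start symbol $\tau$, productions $\beta\to t$ with $\beta\in N$, $t$ a term over $\Sigma$ and $N$) in which all non-terminals are rigid: in a derivation of a term $t$, any two positions at which the same non-terminal occurred must carry the same subterm in $t$. It is acyclic if no non-terminal $\beta$ derives a term containing $\beta$. $L(G)$ is the set of variable-free terms derivable from $\tau$ under the rigidity condition, and $|G|$ is the number of productions of $G$.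
   Formalization: The language is assumed to contain a constant symbol; without one there are no variable-free terms, L(G) is empty, and the equivalence fails (e.g. F = P(x) ∧ ¬P(x) with H = F{x↦α} →). *)

(* Defs.v *)
From HB Require Import structures.
From mathcomp Require Import all_boot finmap.

Set Implicit Arguments.
Unset Strict Implicit.
Unset Printing Implicit Defensive.

Local Open Scope fset_scope.

Record language := Language {
  fun_sym : choiceType;
  pred_sym : Type;
  fun_arity : fun_sym -> nat;
  pred_arity : pred_sym -> nat }.

Unset Elimination Schemes.
Inductive term (L : language) : Type :=
| Var of nat
| App (f : fun_sym L) of {ffun 'I_(fun_arity f) -> term L}.
Set Elimination Schemes.
Arguments Var {L} _.
Arguments App {L} f _.

Lemma term_ind (L : language) (K : term L -> Prop) :
    (forall x, K (Var x)) ->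
    (forall f (ts : {ffun 'I_(fun_arity f) -> term L}),
       (forall i, K (ts i)) -> K (App f ts)) ->
  forall t, K t.
Proof.
move=> KV KA; fix IHt 1 => -[x|f ts]; first exact: KV.
by apply: KA => i; apply: IHt.
Qed.

Section TermChoice.
Variable L : language.

Fixpoint term_enc (t : term L) : GenTree.tree (nat + fun_sym L) :=
  match t with
  | Var x => GenTree.Leaf (inl x)
  | App f ts =>
      GenTree.Node 0 (GenTree.Leaf (inr f) ::
        [seq term_enc (ts i) | i <- enum 'I_(fun_arity f)])
  end.

Fixpoint term_dec (u : GenTree.tree (nat + fun_sym L)) : term L :=
  match u with
  | GenTree.Leaf (inl x) => Var x
  | GenTree.Node _ (GenTree.Leaf (inr f) :: us) =>
      let ts := map term_dec us in App f [ffun i => nth (Var 0) ts (val i)]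
  | _ => Var 0
  end.

Lemma term_encK : cancel term_enc term_dec.
Proof.
elim=> [//|f ts IH] /=; congr (App f _); apply/ffunP=> i; rewrite ffunE.
rewrite -map_comp (nth_map i) ?size_enum_ord //= IH.
by congr (ts _); apply: val_inj; rewrite /= nth_enum_ord.
Qed.

End TermChoice.

HB.instance Definition _ (L : language) :=
  Choice.copy (term L) (can_type (@term_encK L)).

Section Syntax.
Variable L : language.
Implicit Types t u s : term L.

Fixpoint vars t : seq nat :=
  match t with
  | Var x => [:: x]
  | App f ts => flatten [seq vars (ts i) | i <- enum 'I_(fun_arity f)]
  end.

Fixpoint fun_syms t : seq (fun_sym L) :=
  match t with
  | Var _ => [::]
  | App f ts => f :: flatten [seq fun_syms (ts i) | i <- enum 'I_(fun_arity f)]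
  end.

Fixpoint tsubst (x : nat) s t : term L :=
  match t with
  | Var y => if y == x then s else Var y
  | App f ts => App f [ffun i => tsubst x s (ts i)]
  end.

Inductive qf_formula : Type :=
| Atom (p : pred_sym L) of {ffun 'I_(pred_arity p) -> term L}
| Top
| Bot
| Not of qf_formula
| And of qf_formula & qf_formula
| Or of qf_formula & qf_formula
| Imp of qf_formula & qf_formula.

Implicit Types A B F : qf_formula.

Fixpoint fvars A : seq nat :=
  match A with
  | Atom p ts => flatten [seq vars (ts i) | i <- enum 'I_(pred_arity p)]
  | Top | Bot => [::]
  | Not B => fvars B
  | And B C | Or B C | Imp B C => fvars B ++ fvars C
  end.

Fixpoint fsubst (x : nat) s A : qf_formula :=
  match A with
  | Atom p ts => Atom [ffun i => tsubst x s (ts i)]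
  | Top => Top
  | Bot => Bot
  | Not B => Not (fsubst x s B)
  | And B C => And (fsubst x s B) (fsubst x s C)
  | Or B C => Or (fsubst x s B) (fsubst x s C)
  | Imp B C => Imp (fsubst x s B) (fsubst x s C)
  end.

Definition bigAnd (As : seq qf_formula) : qf_formula := foldr And Top As.

(* Propositional validity: distinct atoms, even those that share a predicate
   symbol or contain variables, are independent propositional variables. *)
Definition valuation :=
  forall p : pred_sym L, {ffun 'I_(pred_arity p) -> term L} -> bool.

Fixpoint eval (v : valuation) A : bool :=
  match A with
  | Atom p ts => v p ts
  | Top => true
  | Bot => false
  | Not B => ~~ eval v B
  | And B C => eval v B && eval v C
  | Or B C => eval v B || eval v C
  | Imp B C => eval v B ==> eval v C
  end.

Record sequent := Sequent { antec : seq qf_formula; succed : seq qf_formula }.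

Definition tautology (S : sequent) : Prop :=
  forall v : valuation, all (eval v) (antec S) ==> has (eval v) (succed S).

Record structure := Structure {
  dom : Type;
  dom_inhabited : inhabited dom;
  fun_interp : forall f : fun_sym L, ('I_(fun_arity f) -> dom) -> dom;
  pred_interp : forall p : pred_sym L, ('I_(pred_arity p) -> dom) -> Prop }.

Fixpoint teval (M : structure) (e : nat -> dom M) t : dom M :=
  match t with
  | Var x => e x
  | App f ts => @fun_interp M f (fun i => teval e (ts i))
  end.

Fixpoint holds (M : structure) (e : nat -> dom M) A : Prop :=
  match A with
  | Atom p ts => @pred_interp M p (fun i => teval e (ts i))
  | Top => True
  | Bot => False
  | Not B => ~ holds e B
  | And B C => holds e B /\ holds e C
  | Or B C => holds e B \/ holds e C
  | Imp B C => holds e B -> holds e C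
  end.

Definition holds_forall (M : structure) (e : nat -> dom M) (x : nat) F : Prop :=
  forall d : dom M, holds (fun y => if y == x then d else e y) F.

Definition forall_unsatisfiable (x : nat) F : Prop :=
  forall (M : structure) (e : nat -> dom M), ~ holds_forall e x F.

(* The data (alpha_i, A_i, s_{i,1} ... s_{i,k_i}) of one implication. *)
Record cut := Cut {
  cut_var : nat;
  cut_formula : qf_formula;
  cut_terms : seq (term L) }.

Definition cut_imp (c : cut) : qf_formula :=
  Imp (cut_formula c)
      (bigAnd [seq fsubst (cut_var c) s (cut_formula c) | s <- cut_terms c]).

Record eh_data := EhData {
  eh_terms : seq (term L);
  eh_cuts : seq cut }.

Definition eh_sequent (x : nat) F (H : eh_data) : sequent :=
  Sequent ([seq fsubst x u F | u <- eh_terms H] ++ map cut_imp (eh_cuts H))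
          [::].

Definition eh_size (H : eh_data) : nat :=
  size (eh_terms H) + \sum_(c <- eh_cuts H) size (cut_terms c).

(* Indices start at 0, so [drop i] of the list of the alphas is
   alpha_{i+1}, ..., alpha_n in the usual numbering from 1. *)
Definition extended_herbrand (x : nat) F (H : eh_data) : Prop :=
  let alphas := map cut_var (eh_cuts H) in
  [/\ uniq alphas,
      forall (c0 : cut) (i : nat), i < size (eh_cuts H) ->
        let c := nth c0 (eh_cuts H) i in
        {subset fvars (cut_formula c) <= drop i alphas} /\
        (forall s, s \in cut_terms c -> {subset vars s <= drop i.+1 alphas})
    & tautology (eh_sequent x F H)].

(* Non-terminals are variables, so a term over the signature and the
   non-terminals is an ordinary term, and L(G) consists of ground terms. *)
Record tree_grammar := TreeGrammar {
  nonterms : {fset nat};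
  signature : {fset fun_sym L};
  start : nat;
  prods : {fset nat * term L};
  start_nonterm : start \in nonterms;
  prods_over : forall b t, (b, t) \in prods ->
    [/\ b \in nonterms,
        {subset vars t <= nonterms}
      & {subset fun_syms t <= signature}] }.

Fixpoint subterm t (p : seq nat) : option (term L) :=
  match p, t with
  | [::], _ => Some t
  | i :: p', App f ts =>
      if insub i is Some j then subterm (ts j) p' else None
  | _ :: _, Var _ => None
  end.

Fixpoint replace t (p : seq nat) s : term L :=
  match p, t with
  | [::], _ => s
  | i :: p', App f ts =>
      App f [ffun j => if val j == i then replace (ts j) p' s else ts j]
  | _ :: _, Var _ => t
  end.

Definition step (G : tree_grammar) t t' : Prop :=
  exists (b : nat) (s : term L) (p : seq nat),
    [/\ (b, s) \in prods G, subterm t p = Some (Var b) & t' = replace t p s].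

(* [t :: d] lists all the terms of a derivation that starts at [t] and ends at
   [last t d]; the derivation has [size d] steps. *)
Fixpoint derivation (G : tree_grammar) t (d : seq (term L)) : Prop :=
  if d is t' :: d' then step G t t' /\ derivation G t' d' else True.

Definition rigid (G : tree_grammar) t (d : seq (term L)) : Prop :=
  forall (b : nat) t1 t2 (p q : seq nat),
    b \in nonterms G -> t1 \in t :: d -> t2 \in t :: d ->
    subterm t1 p = Some (Var b) -> subterm t2 q = Some (Var b) ->
    subterm (last t d) p = subterm (last t d) q.

Definition rigid_language (G : tree_grammar) t : Prop :=
  vars t = [::] /\
  exists d, [/\ derivation G (Var (start G)) d,
                rigid G (Var (start G)) d
              & last (Var (start G)) d = t].

(* Only derivations with at least one step count: the empty derivation would
   make every non-terminal derive itself. *)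
Definition acyclic (G : tree_grammar) : Prop :=
  forall (b : nat) (d : seq (term L)), b \in nonterms G -> 0 < size d ->
    derivation G (Var b) d -> b \notin vars (last (Var b) d).

Definition grammar_size (G : tree_grammar) : nat := #|` prods G|.

(* The conjunction over a set of terms is the conjunction over a finite
   enumeration of that set. *)
Definition forms_tautology (x : nat) F (X : term L -> Prop) : Prop :=
  exists ts : seq (term L),
    (forall t, t \in ts <-> X t) /\
    tautology (Sequent [:: bigAnd [seq fsubst x t F | t <- ts]] [::]).

End Syntax.

Arguments Top {L}.
Arguments Bot {L}.

(* Main.v *)
(** In an acyclic totally rigid grammar a ground term is derivable exactly when it
    is [sigma start] for some substitution [sigma] such that every non-terminal [b]
    in use has a production [b -> s] with [sigma b = psubst sigma s].

    From a sequent, take the productions [start -> u_i] and [alpha_i -> s_ij], after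
    replacing by a constant every variable that is not an [alpha_i] with [k_i > 0].
    If a valuation makes all instances of [F] over the language true, then one can
    choose [sigma alpha_n], ..., [sigma alpha_1] in turn so that each implication
    holds under [sigma], which contradicts the validity of the sequent.

    From a grammar, sort the non-terminals topologically as [alpha_1, ..., alpha_n]
    and take for [A_i] the conjunction of the instances of [F] over the terms obtained
    from the right-hand sides of [start] by expanding [alpha_1, ..., alpha_(i-1)];
    the implications then lead from [A_1] to the instances over the language.

    Either translation can lose size (repeated terms on one side, unreachable
    productions on the other), so useless productions or instances are added. *)

Require Import Defs.
From mathcomp Require Import all_boot finmap.

Set Implicit Arguments.
Unset Strict Implicit.
Unset Printing Implicit Defensive.

(** * Substitutions and positions *)

Section Terms.
Variable L : language.
Implicit Types (t u s w : term L) (sigma : nat -> term L) (A : qf_formula L).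

Fixpoint psubst sigma t : term L :=
  match t with
  | Var x => sigma x
  | App f ts => App f [ffun i => psubst sigma (ts i)]
  end.

Definition upd sigma a s : nat -> term L := fun y => if y == a then s else sigma y.

Lemma in_vars_App y f (ts : {ffun 'I_(fun_arity f) -> term L}) :
  reflect (exists i, y \in vars (ts i)) (y \in vars (App f ts)).
Proof.
apply: (iffP flatten_mapP) => [[i _ yi]|[i yi]]; first by exists i.
by exists i; rewrite ?mem_enum.
Qed.

Lemma eq_in_psubst sigma1 sigma2 t :
  {in vars t, sigma1 =1 sigma2} -> psubst sigma1 t = psubst sigma2 t.
Proof.
elim: t => [y|f ts IH] E /=; first by apply: E; rewrite inE.
congr (App f _); apply/ffunP=> i; rewrite !ffunE; apply: IH => y yi.
by apply: E; apply/in_vars_App; exists i.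
Qed.

Lemma psubst_Var t : psubst Var t = t.
Proof.
by elim: t => [//|f ts IH] /=; congr (App f _); apply/ffunP=> i; rewrite ffunE.
Qed.

Lemma psubst_ground sigma t : vars t = [::] -> psubst sigma t = t.
Proof.
by move=> t0; rewrite -[RHS]psubst_Var; apply: eq_in_psubst => y; rewrite t0.
Qed.

Lemma psubst_comp sigma1 sigma2 t :
  psubst sigma1 (psubst sigma2 t) = psubst (fun y => psubst sigma1 (sigma2 y)) t.
Proof.
elim: t => [//|f ts IH] /=; congr (App f _); apply/ffunP=> i.
by rewrite !ffunE IH.
Qed.

Lemma tsubstE x s t : tsubst x s t = psubst (upd Var x s) t.
Proof.
by elim: t => [//|f ts IH] /=; congr (App f _); apply/ffunP=> i; rewrite !ffunE.
Qed.

Lemma psubst_tsubst sigma x s t :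
  psubst sigma (tsubst x s t) = psubst (upd sigma x (psubst sigma s)) t.
Proof.
by rewrite tsubstE psubst_comp; apply: eq_in_psubst => y _; rewrite /upd; case: eqP.
Qed.

Lemma vars_psubst sigma t y :
  y \in vars (psubst sigma t) -> exists2 z, z \in vars t & y \in vars (sigma z).
Proof.
elim: t => [z|f ts IH] /=; first by exists z; rewrite ?inE.
case/in_vars_App=> i; rewrite ffunE => /IH [z zi yz].
by exists z => //; apply/in_vars_App; exists i.
Qed.

Lemma fvars_Atom y p (ts : {ffun 'I_(pred_arity p) -> term L}) i :
  y \in vars (ts i) -> y \in fvars (Atom ts).
Proof. by move=> yi; apply/flatten_mapP; exists i; rewrite ?mem_enum. Qed.

Lemma fvars_fsubst x s A y :
  y \in fvars (fsubst x s A) -> (y \in vars s) || (y \in fvars A) && (y != x).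
Proof.
elim: A => //= [p ts|B IHB C IHC|B IHB C IHC|B IHB C IHC]; last first.
1-3: by rewrite !mem_cat => /orP[/IHB|/IHC] /orP[->|/andP[-> ->]]; rewrite ?orbT.
case/flatten_mapP=> i _; rewrite ffunE tsubstE => /vars_psubst[z zi].
rewrite /upd; case: eqP => [_ ->//|/eqP zx]; rewrite inE => /eqP ->.
by rewrite zx (fvars_Atom zi) orbT.
Qed.

(** Moves a substitution into the valuation: [eval (vcomp v sigma) A] is the value of [A] under
    [sigma]. A tautology is thus instantiated by evaluating it at [vcomp v sigma]. *)
Definition vcomp (v : valuation L) sigma : valuation L :=
  fun p ts => v p [ffun i => psubst sigma (ts i)].

Lemma eq_in_eval v sigma1 sigma2 A :
  {in fvars A, sigma1 =1 sigma2} ->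
  eval (vcomp v sigma1) A = eval (vcomp v sigma2) A.
Proof.
elim: A => //= [p ts|B IHB|B IHB C IHC|B IHB C IHC|B IHB C IHC] E.
- rewrite /vcomp; congr (v p _); apply/ffunP=> i; rewrite !ffunE.
  by apply: eq_in_psubst => y yi; apply: E; apply: fvars_Atom yi.
- by rewrite IHB.
all: by rewrite IHB ?IHC // => y yi; apply: E; rewrite mem_cat yi ?orbT.
Qed.

Lemma eval_fsubst v sigma x s A :
  eval (vcomp v sigma) (fsubst x s A) =
  eval (vcomp v (upd sigma x (psubst sigma s))) A.
Proof.
elim: A => //= [p ts|B ->|B -> C ->|B -> C ->|B -> C ->] //.
rewrite /vcomp; congr (v p _); apply/ffunP=> i; rewrite !ffunE.
by rewrite psubst_tsubst.
Qed.

Lemma eval_vcomp_Var v A : eval (vcomp v Var) A = eval v A.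
Proof.
elim: A => //= [p ts|B ->|B -> C ->|B -> C ->|B -> C ->] //.
rewrite /vcomp; congr (v p _); apply/ffunP=> i; rewrite !ffunE.
by rewrite psubst_Var.
Qed.

Lemma eval_bigAnd v (As : seq (qf_formula L)) : eval v (bigAnd As) = all (eval v) As.
Proof. by elim: As => //= A As ->. Qed.

(** * Positions, replacement and a termination weight *)

Lemma subterm_App f (ts : {ffun 'I_(fun_arity f) -> term L}) i p :
  subterm (App f ts) (val i :: p) = subterm (ts i) p.
Proof. by rewrite /= valK. Qed.

Lemma subterm_nil t : subterm t [::] = Some t. Proof. by case: t. Qed.

Lemma replace_nil t s : replace t [::] s = s. Proof. by case: t. Qed.

(** Induction along the path to a fixed subterm. It absorbs the partiality of [subterm], so that
    later proofs deal with valid positions only. *)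
Lemma subterm_rec s (K : term L -> seq nat -> Prop) :
  K s [::] ->
  (forall f (ts : {ffun 'I_(fun_arity f) -> term L}) i p,
     subterm (ts i) p = Some s -> K (ts i) p -> K (App f ts) (val i :: p)) ->
  forall t p, subterm t p = Some s -> K t p.
Proof.
move=> K0 KS t p; elim: p t => [|i p IH] [y|f ts] //=; first by case=> ->.
  by case=> ->.
by case: insubP => // j _ <- tp; apply: KS => //; apply: IH.
Qed.

Lemma subterm_vars t p s : subterm t p = Some s -> {subset vars s <= vars t}.
Proof.
elim/(@subterm_rec s): t p / => // f ts i p _ IH y /IH yi.
by apply/in_vars_App; exists i.
Qed.

Lemma var_position y t : y \in vars t -> exists p, subterm t p = Some (Var y).
Proof.
elim: t => [z|f ts IH]; first by rewrite inE => /eqP ->; exists [::].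
by case/in_vars_App=> i /IH[p ip]; exists (val i :: p); rewrite subterm_App.
Qed.

Lemma subterm_psubst sigma t p s :
  subterm t p = Some s -> subterm (psubst sigma t) p = Some (psubst sigma s).
Proof.
elim/(@subterm_rec s): t p / => [|f ts i p _ IH]; first by rewrite subterm_nil.
by rewrite [psubst _ _]/= subterm_App ffunE.
Qed.

Lemma subterm_replace t p s u :
  subterm t p = Some s -> subterm (replace t p u) p = Some u.
Proof.
elim/(@subterm_rec s): t p / => [|f ts i p _ IH].
  by rewrite replace_nil subterm_nil.
by rewrite [replace _ _ _]/= subterm_App ffunE eqxx.
Qed.

(** Invariant of derivations: a rewriting step that [sigma] respects leaves the image of the whole
    term unchanged. *)
Lemma psubst_replace sigma t p s u :
  subterm t p = Some s -> psubst sigma s = psubst sigma u ->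
  psubst sigma (replace t p u) = psubst sigma t.
Proof.
move=> tp E; elim/(@subterm_rec s): t p / tp => [|f ts i p _ IH]; first by rewrite replace_nil.
rewrite /=; congr (App f _); apply/ffunP=> j; rewrite !ffunE.
by case: eqP => // /val_inj ->.
Qed.

Lemma vars_replace t p s y :
  y \in vars (replace t p s) -> (y \in vars t) || (y \in vars s).
Proof.
elim: p t => [|i p IH] t; first by rewrite replace_nil => ->; rewrite orbT.
case: t => [z|f ts] /=; first by move=> ->.
case/in_vars_App=> j; rewrite ffunE; case: eqP => [_ /IH /orP[]|_] yj.
- by apply/orP; left; apply/in_vars_App; exists j.
- by rewrite yj orbT.
- by apply/orP; left; apply/in_vars_App; exists j.
Qed.

Lemma vars_sub_replace t p u s y :
  subterm t p = Some u -> y \in vars t ->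
  (y \in vars u) || (y \in vars (replace t p s)).
Proof.
elim/(@subterm_rec u): t p / => [-> //|f ts i p _ IH /in_vars_App[j yj]].
have [ij|ij] := eqVneq (val j) (val i).
  rewrite (val_inj ij) in yj; case/orP: (IH yj) => [->//|yr].
  apply/orP; right; apply/in_vars_App; exists i.
  by rewrite ffunE eqxx.
by apply/orP; right; apply/in_vars_App; exists j; rewrite ffunE (negPf ij).
Qed.

(** Termination measure: rewriting lowers it as soon as each right-hand side weighs less than its
    non-terminal. With [h] constantly 1 it counts variable occurrences. *)
Fixpoint weight (h : nat -> nat) t : nat :=
  match t with
  | Var x => h x
  | App f ts => \sum_i weight h (ts i)
  end.

Lemma weight_replace h t p b s :
  subterm t p = Some (Var b) -> weight h s < h b ->
  weight h (replace t p s) < weight h t.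
Proof.
move=> tp lt_s; elim/(@subterm_rec (Var b)): t p / tp => [|f ts i p _ IH] /=; first by [].
rewrite (bigD1 i) //= [ltnRHS](bigD1 i) //= ffunE eqxx -addSn leq_add //.
by rewrite leq_eqVlt; apply/orP; left; apply/eqP; apply: eq_bigr => j ji;
  rewrite ffunE -(inj_eq val_inj) in ji *; rewrite (negPf ji).
Qed.

Lemma weight_le h m t :
  (forall y, y \in vars t -> h y <= m) -> weight h t <= weight (fun=> 1) t * m.
Proof.
elim: t => [y|f ts IH] hm /=; first by rewrite mul1n; apply: hm; rewrite inE.
rewrite big_distrl /=; apply: leq_sum => i _; apply: IH => y yi.
by apply: hm; apply/in_vars_App; exists i.
Qed.

Lemma weight_ground h t : vars t = [::] -> weight h t = 0.
Proof.
move=> t0; apply/eqP; rewrite -leqn0 -(muln0 (weight (fun=> 1) t)).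
by apply: weight_le => y; rewrite t0.
Qed.
End Terms.

(** * Derivable ground terms as substitution instances *)

Section Grammars.
Variable L : language.
Implicit Types (t u s w : term L) (sigma : nat -> term L) (G : tree_grammar L).

Lemma derivation_prefix G t d t2 :
  derivation G t d -> t2 \in d ->
  exists d1, [/\ 0 < size d1, derivation G t d1 & last t d1 = t2].
Proof.
elim: d t => // t1 d IH t [st dd]; rewrite inE => /predU1P[->|/(IH _ dd)].
  by exists [:: t1].
by case=> d1 [_ dd1 <-]; exists (t1 :: d1).
Qed.

Lemma derivation_rcons G t d t2 :
  derivation G t d -> step G (last t d) t2 -> derivation G t (rcons d t2).
Proof.
by elim: d t => [|t1 d IH] t /= => [_ //|[st dd] st2]; split=> //; apply: IH.
Qed.

Lemma derivation_vars G t d t1 :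
  {subset vars t <= nonterms G} -> derivation G t d -> t1 \in t :: d ->
  {subset vars t1 <= nonterms G}.
Proof.
elim: d t => [|t' d IH] t tN; first by rewrite inE => _ /eqP ->.
move=> [[b [s [p [bs _ E]]]] dd]; rewrite inE => /predU1P[-> //|].
apply: IH dd => y; rewrite E => /vars_replace /orP[/tN //|].
by case: (prods_over bs) => _ sN _ /sN.
Qed.

(** Choice over a finite list, built one element at a time; [t0] is the value off the list. *)
Lemma finite_choice (I : eqType) (T : Type) (P : I -> T -> Prop) (t0 : T) (bs : seq I) :
  (forall b, b \in bs -> exists v, P b v) ->
  exists f : I -> T, forall b, b \in bs -> P b (f b).
Proof.
elim: bs => [|b bs IH] ex; first by exists (fun=> t0).
have [c cbs|f fP] := IH; first by apply: ex; rewrite inE cbs orbT.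
have [|v bv] := ex b; first by rewrite inE eqxx.
exists (fun c => if c == b then v else f c) => c; rewrite inE.
by case: eqP => [-> //|_] /=; apply: fP.
Qed.

(* Read backwards from the ground term, every rewriting step is undone by the
   substitution that sends a non-terminal to its unique final subterm. *)
Lemma derivation_psubst G t d sigma :
  derivation G t d -> vars (last t d) = [::] ->
  (forall t1 p b, t1 \in t :: d -> subterm t1 p = Some (Var b) ->
     odflt (Var 0) (subterm (last t d) p) = sigma b) ->
  psubst sigma t = last t d /\
  (forall t1 b, t1 \in t :: d -> b \in vars t1 ->
     exists s, [/\ (b, s) \in prods G, sigma b = psubst sigma s
       & exists2 t2, t2 \in d & {subset vars s <= vars t2}]).
Proof.
elim: d t => [|t' d IH] t /=.
  move=> _ t0 _; split=> [|t1 b]; first exact: psubst_ground.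
  by rewrite inE => /eqP ->; rewrite t0.
move=> [[b [s [p [bs tp E]]]] dd] w0 H.
have [|Et' P] := IH t' dd w0.
  by move=> t1 q c t1d; apply: H; rewrite inE t1d orbT.
have t'p : subterm t' p = Some s by rewrite E; apply: subterm_replace tp.
have Eb : sigma b = psubst sigma s.
  by rewrite -(H t p b (mem_head _ _) tp) -Et' (subterm_psubst _ t'p).
split; first by rewrite -Et' E (psubst_replace tp).
move=> t1 c; rewrite inE => /predU1P[->|t1d] ct1; last first.
  have [s' [cs' Ec [t2 t2d s't2]]] := P _ _ t1d ct1.
  by exists s'; split=> //; exists t2; rewrite // inE t2d orbT.
have := vars_sub_replace s tp ct1; rewrite inE => /orP[/eqP ->|].
  exists s; split=> //; exists t'; first exact: mem_head.
  exact: subterm_vars t'p.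
rewrite -E => /(P _ _ (mem_head _ _)) [s' [cs' Ec [t2 t2d s't2]]].
by exists s'; split=> //; exists t2; rewrite // inE t2d orbT.
Qed.

(** Rigidity makes the final subterm below a non-terminal independent of the occurrence, and this
    subterm is its value under [sigma]. [D] collects the non-terminals in terms reached by at least
    one step, so acyclicity keeps the start symbol out of it. *)
Lemma rigid_language_psubst G w :
  acyclic G -> rigid_language G w ->
  exists sigma (D : seq nat),
    [/\ sigma (start G) = w, start G \notin D
      & forall b, b \in start G :: D ->
          exists s, [/\ (b, s) \in prods G, sigma b = psubst sigma s
                      & {subset vars s <= D}]].
Proof.
move=> acG [w0 [d [dd rig Ew]]]; set t0 := Var (start G) in dd rig Ew.
have dN t1 : t1 \in t0 :: d -> {subset vars t1 <= nonterms G}.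
  apply: derivation_vars dd => y; rewrite inE => /eqP ->; exact: start_nonterm.
pose occ b t1 p := t1 \in t0 :: d /\ subterm t1 p = Some (Var b).
(* [f] fixes the position of one occurrence of each non-terminal; by rigidity every other occurrence
   ends in the same subterm of [w]. *)
have [|f fP] := @finite_choice _ _ (fun b p => forall t1 q,
    occ b t1 q -> subterm w q = subterm w p) [::] (flatten (map (@vars L) (t0 :: d))).
  move=> b /flatten_mapP[t1 t1d bt1]; have [p tp] := var_position bt1.
  exists p => t2 q [t2d t2q]; rewrite -Ew; apply: (rig b t2 t1) => //.
  exact: (dN t1).
pose sigma b := odflt (Var 0) (subterm w (f b)).
have [|t1 p b t1d tp|Et0 P] := @derivation_psubst G t0 d sigma dd; first by rewrite Ew.
  rewrite Ew (fP b _ t1 p) //; apply/flatten_mapP; exists t1 => //.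
  by apply: (subterm_vars tp); rewrite inE.
exists sigma, (flatten (map (@vars L) d)); split; first by rewrite -Ew -Et0.
  apply/flatten_mapP=> -[t1 t1d bt1].
  have [d1 [d1_gt0 dd1 E1]] := derivation_prefix dd t1d.
  by have := acG _ _ (start_nonterm G) d1_gt0 dd1; rewrite E1 bt1.
move=> b bD; have [t1 t1d bt1] : exists2 t1, t1 \in t0 :: d & b \in vars t1.
  move: bD; rewrite inE => /predU1P[->|/flatten_mapP[t1 t1d bt1]].
    by exists t0; rewrite inE eqxx.
  by exists t1; rewrite // inE t1d orbT.
have [s [bs Eb [t2 t2d st2]]] := P _ _ t1d bt1.
by exists s; split=> // y ys; apply/flatten_mapP; exists t2; rewrite ?st2.
Qed.

(* The converse of [rigid_language_psubst]; the ranks ensure that rewriting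
   terminates. *)
Lemma psubst_rigid_language G sigma (r : nat -> nat) (D : seq nat) :
  (forall b s y, (b, s) \in prods G -> y \in vars s -> r y < r b) ->
  start G \in D -> vars (sigma (start G)) = [::] ->
  (forall b, b \in D -> exists s, [/\ (b, s) \in prods G, sigma b = psubst sigma s
                      & {subset vars s <= D}]) ->
  rigid_language G (sigma (start G)).
Proof.
move=> rP startD w0 DP; set w := sigma _ in w0 *; split=> //.
pose one := fun _ : nat => 1.
(* [M] exceeds the number of variable occurrences in every right-hand side. Since those variables
   have smaller rank, the right-hand side weighs less than [M ^ r b]. *)
pose M := (\max_(c <- prods G) weight one c.2).+1.
pose h y := M ^ r y.
have h_prod b s : (b, s) \in prods G -> weight h s < h b.
  move=> bs; have [s0|s_neq0] := eqVneq (vars s) [::].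
    by rewrite weight_ground // expn_gt0.
  have rb_gt0 : 0 < r b.
    by case E: (vars s) s_neq0 => [//|y ys] _; apply: leq_ltn_trans (rP _ _ y bs _);
      rewrite // E inE eqxx.
  have le_s : weight h s <= weight one s * M ^ (r b).-1.
    apply: weight_le => y ys; apply: leq_pexp2l => //.
    by rewrite -ltnS prednK ?(rP b s).
  apply: leq_ltn_trans le_s _; rewrite /h -[in ltnRHS](prednK rb_gt0) expnS.
  rewrite ltn_pmul2r ?expn_gt0 // ltnS.
  exact: (@leq_bigmax_seq _ _ xpredT (fun c => weight one c.2) (b, s)).
(* Induction on the weight: some variable of [t] is rewritten by the production that [sigma]
   respects, which keeps the image [w]. *)
have ex n : forall t, weight h t < n -> psubst sigma t = w -> {subset vars t <= D} ->
    exists d, [/\ derivation G t d, last t d = w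
      & forall t1, t1 \in t :: d -> psubst sigma t1 = w].
  elim: n => // n IH t lt_n tw tD.
  have [t0|] := eqVneq (vars t) [::].
    exists [::]; split=> //=; first by rewrite -tw psubst_ground.
    by move=> t1; rewrite inE => /eqP ->.
  case E: (vars t) => [//|y ys] _.
  have yt : y \in vars t by rewrite E mem_head.
  have [p tp] := var_position yt; have [s [ys' Ey sD]] := DP _ (tD _ yt).
  have [|||d [dd Ed dP]] := IH (replace t p s).
  - by apply: leq_trans (weight_replace tp (h_prod _ _ ys')) _.
  - by rewrite (psubst_replace tp).
  - by move=> z /vars_replace /orP[/tD|/sD].
  exists (replace t p s :: d); split=> //=; first by split=> //; exists y, s, p.
  by move=> t1; rewrite inE => /predU1P[->|/dP].
have [||d [dd Ed dP]] := ex _ (Var (start G)) (ltnSn _).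
- by [].
- by move=> y; rewrite inE => /eqP ->.
(* Rigidity: every term of the derivation has image [w], so [w] carries [sigma b] wherever [b]
   occurred. *)
exists d; split=> // b t1 t2 p q _ /dP t1w /dP t2w t1p t2q.
have := subterm_psubst sigma t1p; have := subterm_psubst sigma t2q.
by rewrite Ed t1w t2w => -> ->.
Qed.

(** The first step rewrites [Var b] at the root; from then on all variables have rank below [r b],
    and further steps preserve this. *)
Lemma acyclic_rank G (r : nat -> nat) :
  (forall b s y, (b, s) \in prods G -> y \in vars s -> r y < r b) -> acyclic G.
Proof.
move=> rP b [//|t d] _ _ [[c [s [p [cs bp Et]]]] dd].
have {cs bp p Et} [bs Et] : (b, s) \in prods G /\ t = s.
  by rewrite Et; case: p bp cs {Et} => [|//] [->].
have below d' t' : derivation G t' d' -> (forall y, y \in vars t' -> r y < r b) ->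
    forall y, y \in vars (last t' d') -> r y < r b.
  elim: d' t' => [//|t1 d' IH] t' [[c' [s' [q [cs' t'q E]]]] dd'] t'b.
  apply: IH dd' _ => y; rewrite E => /vars_replace /orP[/t'b //|ys'].
  apply: ltn_trans (rP _ _ _ cs' ys') (t'b _ _).
  by apply: (subterm_vars t'q); rewrite inE.
rewrite Et in dd *; apply/negP=> /(below _ _ dd (fun y => rP b s y bs)).
by rewrite ltnn.
Qed.
End Grammars.

(** * Substitutions generated by the cuts *)

Section Cuts.
Variable L : language.
Implicit Types (t u s w : term L) (sigma : nat -> term L) (A F : qf_formula L).
Implicit Types (c : cut L) (cs : seq (cut L)) (v : valuation L).

(** The indexed variable conditions of [extended_herbrand] in recursive form, so that cuts can be
    peeled off from the front. *)
Fixpoint wf_cuts cs : Prop :=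
  if cs is c :: cs' then
    [/\ cut_var c \notin map (@cut_var L) cs',
        {subset fvars (cut_formula c) <= map (@cut_var L) cs},
        forall s, s \in cut_terms c -> {subset vars s <= map (@cut_var L) cs'}
      & wf_cuts cs']
  else True.

Lemma extended_herbrandP x F (H : eh_data L) :
  extended_herbrand x F H <-> wf_cuts (eh_cuts H) /\ tautology (eh_sequent x F H).
Proof.
rewrite /extended_herbrand; case: H => us cs /=; move: (tautology _) => T.
suff -> : wf_cuts cs <-> uniq (map (@cut_var L) cs) /\
    forall (c0 : cut L) i, i < size cs ->
      {subset fvars (cut_formula (nth c0 cs i)) <= drop i (map (@cut_var L) cs)} /\
      (forall s, s \in cut_terms (nth c0 cs i) ->
         {subset vars s <= drop i.+1 (map (@cut_var L) cs)}).
  by split=> [[? ? ?]|[[? ?] ?]].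
elim: cs => [|c cs IH]; first by [].
split=> [[c_notin Ac sc /IH [cs_uniq ncs]]|[/= /andP[c_notin cs_uniq] ncs]].
  split=> [|c0 [|i] lti]; first by rewrite /= c_notin.
    by rewrite /= drop0; split.
  exact: ncs.
split=> //; first by have [] := ncs c 0 isT.
  by have [_] := ncs c 0 isT; rewrite /= drop0.
by apply/IH; split=> // c0 i lti; apply: (ncs c0 i.+1).
Qed.

Lemma eval_vcomp_fsubst v sigma x u F : {subset fvars F <= [:: x]} ->
  eval (vcomp v sigma) (fsubst x u F) = eval v (fsubst x (psubst sigma u) F).
Proof.
move=> Fx; rewrite -[RHS]eval_vcomp_Var !eval_fsubst psubst_Var.
by apply: eq_in_eval => y /Fx; rewrite inE /upd => ->.
Qed.

Definition env_subst g (e : seq (nat * term L)) : nat -> term L :=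
  foldr (fun p sigma => upd sigma p.1 p.2) (fun=> g) e.

(** Assignments are built from the last cut to the first, since the terms of a cut mention later
    variables only. A cut without terms is skipped: a product with its empty list would leave no
    assignment at all. Its variable then has the default value [g]. *)
Fixpoint cut_envs g cs : seq (seq (nat * term L)) :=
  if cs is c :: cs' then
    if nilp (cut_terms c) then cut_envs g cs' else
    [seq (cut_var c, psubst (env_subst g e) s) :: e
       | e <- cut_envs g cs', s <- cut_terms c]
  else [:: [::]].

Definition cut_prods cs : seq (nat * term L) :=
  flatten [seq [seq (cut_var c, s) | s <- cut_terms c] | c <- cs].

Definition live cs : seq nat := [seq p.1 | p <- cut_prods cs].

(** Applied with [live cs] for [K]: any other variable has no production and would block the
    derivation of a ground term, so [g] takes its place. *)
Definition prune (K : pred nat) g t : term L :=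
  psubst (fun y => if K y then Var y else g) t.

Lemma cut_prods_cons c cs a s : ((a, s) \in cut_prods (c :: cs)) =
  (a == cut_var c) && (s \in cut_terms c) || ((a, s) \in cut_prods cs).
Proof.
rewrite /cut_prods /= mem_cat; congr (_ || _); apply/mapP/andP.
  by case=> s' s'c [-> ->]; rewrite eqxx.
by case=> /eqP -> sc; exists s.
Qed.

Lemma live_cons c cs y : (y \in live (c :: cs)) =
  (y == cut_var c) && ~~ nilp (cut_terms c) || (y \in live cs).
Proof.
rewrite /live /cut_prods /= map_cat mem_cat; congr (_ || _); rewrite -map_comp.
apply/mapP/andP => [[s sc ->]|[/eqP ->]]; first by case: (cut_terms c) sc.
by case: (cut_terms c) => // s ss _; exists s; rewrite ?mem_head.
Qed.

Lemma live_sub cs : {subset live cs <= map (@cut_var L) cs}.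
Proof.
elim: cs => // c cs IH y; rewrite live_cons inE.
by case/orP=> [/andP[->]//|/IH ->]; rewrite orbT.
Qed.

Lemma cut_prods_live cs a s : (a, s) \in cut_prods cs -> a \in live cs.
Proof. by move=> ascs; apply/mapP; exists (a, s). Qed.

Lemma cut_envsP g c cs e : e \in cut_envs g (c :: cs) ->
  if nilp (cut_terms c) then e \in cut_envs g cs : Prop
  else exists e' s, [/\ e' \in cut_envs g cs, s \in cut_terms c
                       & e = (cut_var c, psubst (env_subst g e') s) :: e'].
Proof.
by rewrite /=; case: ifP => // _ /allpairsP[[e' s] [/= ? ? ->]]; exists e', s.
Qed.

Lemma env_subst_out g cs e y : e \in cut_envs g cs -> y \notin live cs ->
  env_subst g e y = g.
Proof.
elim: cs e => [|c cs IH] e; first by rewrite inE => /eqP ->.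
move/cut_envsP; rewrite live_cons; case: ifP => _; first by rewrite andbF; apply: IH.
case=> e' [s [e'c _ ->]]; rewrite andbT negb_or => /andP[yc yl].
by rewrite /= /upd (negPf yc); apply: IH.
Qed.

Lemma env_subst_ground g cs e y : vars g = [::] -> e \in cut_envs g cs ->
  vars (env_subst g e y) = [::].
Proof.
move=> g0; elim: cs e y => [|c cs IH] e y; first by rewrite inE => /eqP ->.
move/cut_envsP; case: ifP => _; first exact: IH.
case=> e' [s [e'c _ ->]]; rewrite /= /upd; case: eqP => _; last exact: IH.
case E: (vars _) => [//|z zs]; have := mem_head z zs; rewrite -E.
by case/vars_psubst=> y' _; rewrite (IH _ _ e'c).
Qed.

Lemma psubst_prune (K : pred nat) g sigma t : vars g = [::] ->
  (forall y, y \in vars t -> ~~ K y -> sigma y = g) ->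
  psubst sigma (prune K g t) = psubst sigma t.
Proof.
move=> g0 Kg; rewrite /prune psubst_comp; apply: eq_in_psubst => y yt.
by case: ifPn => // Ky; rewrite psubst_ground // Kg.
Qed.

Lemma vars_prune (K : pred nat) g t y : vars g = [::] ->
  y \in vars (prune K g t) -> K y && (y \in vars t).
Proof.
move=> g0 /vars_psubst[z zt]; case: ifP => Kz; last by rewrite g0.
by rewrite inE => /eqP ->; rewrite Kz zt.
Qed.

Lemma psubst_upd_fresh sigma a s t : a \notin vars t ->
  psubst (upd sigma a s) t = psubst sigma t.
Proof.
move=> at_; apply: eq_in_psubst => y yt; rewrite /upd; case: eqP => // ya.
by rewrite -ya yt in at_.
Qed.

Lemma wf_cuts_index cs a s y : wf_cuts cs -> (a, s) \in cut_prods cs -> y \in vars s ->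
  index a (map (@cut_var L) cs) < index y (map (@cut_var L) cs) < size cs.
Proof.
move=> wf ascs ys; rewrite -(size_map (@cut_var L)) index_mem.
elim: cs wf ascs => // c1 cs IH [c1_notin _ sc1 wf].
have c1_neq z : z \in map (@cut_var L) cs -> (cut_var c1 == z) = false.
  by move=> zc; apply: contraNF c1_notin => /eqP ->.
rewrite cut_prods_cons => /orP[/andP[/eqP -> sc]|ascs].
  have yc : y \in map (@cut_var L) cs by apply: (sc1 s).
  by rewrite /= eqxx c1_neq // inE yc orbT.
have /andP[lt_ay yc] := IH wf ascs.
have acs := live_sub (cut_prods_live ascs).
by rewrite /= !c1_neq // ltnS lt_ay inE yc orbT.
Qed.

(** Each value is computed from the later ones; assigning earlier variables afterwards does not
    disturb the equation, because they do not occur in [s]. *)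
Lemma env_subst_live g cs e a : wf_cuts cs -> e \in cut_envs g cs -> a \in live cs ->
  exists2 s, (a, s) \in cut_prods cs
    & env_subst g e a = psubst (env_subst g e) s.
Proof.
elim: cs e => // c cs IH e [c_notin _ sc wf] /cut_envsP; rewrite live_cons.
case: ifP => _ => [ec|[e' [s [e'c cs' ->]]]].
  rewrite andbF => /(IH _ wf ec)[s ascs Es].
  by exists s; rewrite // cut_prods_cons ascs orbT.
have fresh t : {subset vars t <= map (@cut_var L) cs} -> cut_var c \notin vars t.
  by move=> tcs; apply: contra c_notin => /tcs.
have [-> _|ac /=] := eqVneq a (cut_var c).
  exists s; first by rewrite cut_prods_cons eqxx cs'.
  by rewrite /= {1}/upd eqxx psubst_upd_fresh //; apply/fresh/sc.
move=> al; have [s' ascs Es] := IH _ wf e'c al.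
exists s'; first by rewrite cut_prods_cons ascs orbT.
rewrite /= {1}/upd (negPf ac) Es psubst_upd_fresh //; apply: fresh => y.
by case/(wf_cuts_index wf ascs)/andP=> _; rewrite -(size_map (@cut_var L)) index_mem.
Qed.

(* Choosing the substitution from the last cut to the first, an implication that
   would fail is repaired by the instance of its conclusion that is false. *)
Lemma cut_envs_eval g cs v : wf_cuts cs ->
  exists2 e, e \in cut_envs g cs
    & all (eval (vcomp v (env_subst g e))) (map (@cut_imp L) cs).
Proof.
elim: cs => [_|c cs IH [c_notin Ac sc wf]]; first by exists [::].
have [e ec e_all] := IH wf; set sigma := env_subst g e in e_all.
(* By the variable conditions the later implications do not mention [cut_var c], so its value can be
   chosen freely. *)
have fresh s : all (eval (vcomp v (upd sigma (cut_var c) s))) (map (@cut_imp L) cs).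
  elim: cs wf c_notin e_all {IH Ac sc ec} => //= c1 cs IH1 [_ A1 s1 wf].
  rewrite inE negb_or => /andP[cc1 c_notin] /andP[e1 e_all].
  rewrite {}IH1 // andbT; apply: etrans e1.
  apply: (@eq_in_eval _ _ _ _ (cut_imp c1)) => y /=; rewrite mem_cat.
  move=> yc; have {yc} : y \in cut_var c1 :: map (@cut_var L) cs.
    case/orP: yc => [/A1 //|].
    elim: (cut_terms c1) s1 => //= s' ss IHs s1; rewrite mem_cat => /orP[].
      case/fvars_fsubst/orP=> [ys'|/andP[/A1 //]].
      by rewrite inE (s1 s' (mem_head _ _) y ys') orbT.
    by apply: IHs => s'' s''s; apply: s1; rewrite inE s''s orbT.
  rewrite /upd; case: eqP => // ->; rewrite inE (negPf cc1) /=.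
  by rewrite (negPf c_notin).
rewrite /=; case: ifPn => [/nilP c0|c0].
  by exists e; rewrite //= e_all c0 /= implybT.
have eval_concl sigma' : eval (vcomp v sigma') (bigAnd
    [seq fsubst (cut_var c) s (cut_formula c) | s <- cut_terms c]) =
  all (fun s => eval (vcomp v (upd sigma' (cut_var c) (psubst sigma' s)))
         (cut_formula c)) (cut_terms c).
  rewrite eval_bigAnd all_map; apply: eq_all => s0 /=; exact: eval_fsubst.
pose A s := eval (vcomp v (upd sigma (cut_var c) (psubst sigma s))) (cut_formula c).
have [s cs' As] : exists2 s, s \in cut_terms c & A s ==> all A (cut_terms c).
  have [allA|] := boolP (all A (cut_terms c)).
    by case: (cut_terms c) c0 => // s ss _; exists s; rewrite ?mem_head ?implybT.
  by case/allPn=> s ss /negPf As; exists s; rewrite ?As.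
exists ((cut_var c, psubst sigma s) :: e); first by apply/allpairsP; exists (e, s).
rewrite /= fresh andbT eval_concl //; congr (_ ==> _): As.
apply: eq_in_all => s0 s0c; apply: eq_in_eval => y _ /=.
rewrite -/sigma psubst_upd_fresh; last by apply: contra c_notin => /(sc _ s0c).
by rewrite /upd; case: eqP.
Qed.

(** Completeness of [cut_envs]: a [rho] that follows productions on [D] coincides there with one of
    the assignments. [K] is separate from [live cs] because pruning refers to the full list of cuts,
    which the induction shortens. *)
Lemma cut_envs_agree (K : pred nat) g cs (D : seq nat) rho :
  vars g = [::] -> wf_cuts cs ->
  (forall y, y \in map (@cut_var L) cs -> K y = (y \in live cs)) ->
  (forall b, b \in D -> b \in live cs -> exists s,
     [/\ (b, s) \in cut_prods cs, rho b = psubst rho (prune K g s)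
       & {subset vars (prune K g s) <= D}]) ->
  exists2 e, e \in cut_envs g cs &
    forall b, b \in D -> b \in live cs -> env_subst g e b = rho b.
Proof.
move=> g0; elim: cs => [|c cs IH]; first by exists [::].
case=> c_notin _ sc wf KP DP.
have c_neq y : y \in map (@cut_var L) cs -> (y == cut_var c) = false.
  by move=> yc; apply: contraNF c_notin => /eqP <-.
have KP' y : y \in map (@cut_var L) cs -> K y = (y \in live cs).
  by move=> yc; rewrite KP ?inE ?yc ?orbT // live_cons c_neq.
have [e ec eD] : exists2 e, e \in cut_envs g cs &
    forall b, b \in D -> b \in live cs -> env_subst g e b = rho b.
  apply: IH => // b bD bl.
  have [|s [bs Es sD]] := DP b bD; first by rewrite live_cons bl orbT.
  by exists s; split=> //; move: bs; rewrite cut_prods_cons c_neq ?(live_sub bl).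
rewrite /=; case: ifPn => [c0|c0].
  by exists e => // b bD; rewrite live_cons c0 andbF; apply: eD.
(* If the variable is in [D], the term is the one that [rho] follows; otherwise any term will do. *)
have [s cs' Es] : exists2 s, s \in cut_terms c &
    cut_var c \in D -> rho (cut_var c) = psubst (env_subst g e) s.
  have [cD|cD] := boolP (cut_var c \in D); last first.
    by case: (cut_terms c) c0 => // s ss _; exists s; rewrite ?mem_head.
  have [|s [bs Es sD]] := DP _ cD; first by rewrite live_cons c0 eqxx.
  have c's : s \in cut_terms c.
    move: bs; rewrite cut_prods_cons eqxx => /orP[//|/cut_prods_live/live_sub].
    by rewrite (negPf c_notin).
  exists s => // _; rewrite Es.
  rewrite -[RHS](@psubst_prune K g) // => [|y ys Ky]; last first.
    by apply: (env_subst_out ec); rewrite -KP' //; apply: (sc s).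
  apply: eq_in_psubst => y ys; apply/esym/eD; first exact: sD.
  by case/andP: (vars_prune g0 ys) => Ky /(sc _ c's) /KP' <-.
exists ((cut_var c, psubst (env_subst g e) s) :: e); first by apply/allpairsP; exists (e, s).
move=> b bD; rewrite live_cons /= /upd; case: eqP => [Eb _|_ /=]; last exact: eD.
by rewrite Eb Es // -Eb.
Qed.

End Cuts.

(** * From sequents to grammars *)

Lemma in_fset_seq (T : choiceType) (s : seq T) z : (z \in [fset y in s]%fset) = (z \in s).
Proof. by rewrite inE. Qed.

Section GrammarOfSequent.
Variable L : language.
Variables (g : term L) (us : seq (term L)) (cs : seq (cut L)) (k : nat).

Let alphas := map (@cut_var L) cs.

Definition fresh_nat (s : seq nat) : nat := (\max_(y <- s) y).+1.

Lemma fresh_natP s y : y \in s -> y < fresh_nat s.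
Proof. by move=> ys; rewrite ltnS (leq_bigmax_seq (F := id)). Qed.

(** Larger than every cut variable, which leaves the numbers above it for the padding. *)
Definition eh_start : nat := fresh_nat alphas.

Definition eh_star (t : term L) : term L := prune (mem (live cs)) g t.

Definition eh_prods : seq (nat * term L) :=
  [seq (eh_start, eh_star u) | u <- us] ++
  [seq (p.1, eh_star p.2) | p <- cut_prods cs].

Lemma size_eh_prods : size eh_prods = eh_size (EhData us cs).
Proof.
rewrite size_cat !size_map size_flatten /shape sumnE big_map big_map.
by rewrite /eh_size /=; congr (_ + _); apply: eq_bigr => c _; rewrite size_map.
Qed.

(* Productions of unreachable non-terminals, which only adjust the size. *)
Definition padding : seq (nat * term L) := [seq (eh_start + i.+1, g) | i <- iota 0 k].

Let all_prods := eh_prods ++ padding.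

Hypothesis g0 : vars g = [::].

Lemma eh_prodsP b s : (b, s) \in eh_prods ->
  (exists2 u, u \in us & b = eh_start /\ s = eh_star u) \/
  (exists2 s', (b, s') \in cut_prods cs & s = eh_star s').
Proof.
rewrite mem_cat => /orP[/mapP[u uus [-> ->]]|/mapP[[a s'] ascs [-> ->]]].
  by left; exists u.
by right; exists s'.
Qed.

Lemma paddingP b s : (b, s) \in padding -> eh_start < b /\ s = g.
Proof. by case/mapP=> i _ [-> ->]; rewrite -addSnnS leq_addr. Qed.

Lemma vars_eh_star t y : y \in vars (eh_star t) -> y \in live cs.
Proof. by case/(vars_prune g0)/andP. Qed.

Lemma live_lt_start y : y \in live cs -> y < eh_start.
Proof. by move/live_sub/fresh_natP. Qed.

Definition eh_nonterms : {fset nat} :=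
  [fset y in eh_start :: live cs ++ map (@fst _ _) padding]%fset.

Definition eh_signature : {fset fun_sym L} :=
  [fset f in flatten [seq fun_syms p.2 | p <- all_prods]]%fset.

Lemma eh_start_nonterm : eh_start \in eh_nonterms.
Proof. by rewrite in_fset_seq mem_head. Qed.

Lemma eh_prods_over b t : (b, t) \in [fset p in all_prods]%fset ->
  [/\ b \in eh_nonterms, {subset vars t <= eh_nonterms}
    & {subset fun_syms t <= eh_signature}].
Proof.
rewrite in_fset_seq => bt; split; last first.
- by move=> f ft; rewrite in_fset_seq; apply/flatten_mapP; exists (b, t).
- move: bt; rewrite mem_cat => /orP[/eh_prodsP|/paddingP[_ ->]]; last by rewrite g0.
  by case=> [[u _ [_ ->]]|[u _ ->]] y /vars_eh_star yl; rewrite in_fset_seq inE mem_cat yl orbT.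
rewrite in_fset_seq in_cons (mem_cat _ (live cs)).
move: bt; rewrite mem_cat => /orP[/eh_prodsP[[u _ [-> _]]|[s' bs' _]]|bt].
- by rewrite eqxx.
- by rewrite (cut_prods_live bs') orbT.
- by rewrite (map_f (@fst _ _) bt) !orbT.
Qed.

Definition eh_grammar : tree_grammar L :=
  TreeGrammar eh_start_nonterm eh_prods_over.

Lemma eh_grammar_size : grammar_size eh_grammar = size (undup eh_prods) + k.
Proof.
rewrite /grammar_size /= card_fseq undup_cat size_cat; congr (size _ + _).
  rewrite -[RHS]filter_predT; apply: eq_in_filter => -[b s]; rewrite mem_undup /=.
  move=> bs; apply/negP=> /paddingP[lt_b _]; case: (eh_prodsP bs).
    by case=> u _ [Eb _]; rewrite Eb ltnn in lt_b.
  by case=> s' /cut_prods_live/live_lt_start lt_b'; rewrite ltnNge ltnW in lt_b.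
rewrite undup_id ?size_map ?size_iota // map_inj_uniq ?iota_uniq //.
by move=> i j [] /addnI [].
Qed.

Hypothesis wf : wf_cuts cs.

(** Cut terms mention later variables only, so the distance to the end of the list is a rank; the
    start symbol goes on top. *)
Definition eh_rank y : nat :=
  if y == eh_start then (size cs).+1 else size cs - index y alphas.

Lemma eh_rankP b s y :
  (b, s) \in prods eh_grammar -> y \in vars s -> eh_rank y < eh_rank b.
Proof.
rewrite in_fset_seq mem_cat => /orP[/eh_prodsP|/paddingP[_ ->]]; last by rewrite g0.
rewrite /eh_rank.
case=> [[u _ [-> ->]]|[s' bs' ->]] /(vars_prune g0)/andP[yl ys].
  by rewrite eqxx ltn_eqF ?live_lt_start // ltnS leq_subr.
have bl := cut_prods_live bs'.
rewrite !ltn_eqF ?live_lt_start //.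
by have /andP[lt1 lt2] := wf_cuts_index wf bs' ys; rewrite ltn_sub2l // (ltn_trans lt1).
Qed.

Lemma eh_grammar_acyclic : acyclic eh_grammar.
Proof. exact: acyclic_rank eh_rankP. Qed.

Definition eh_language : seq (term L) :=
  [seq psubst (env_subst g e) u | e <- cut_envs g cs, u <- us].

Lemma psubst_eh_star e t : e \in cut_envs g cs ->
  psubst (env_subst g e) (eh_star t) = psubst (env_subst g e) t.
Proof. by move=> ec; apply: psubst_prune => // y _; apply: env_subst_out ec. Qed.

Lemma eh_language_rigid w : w \in eh_language -> rigid_language eh_grammar w.
Proof.
case/allpairsP=> -[e u] /= [ec uus ->]; set w0 := psubst _ _.
pose sigma := upd (env_subst g e) eh_start w0.
have sigma_star t : psubst sigma (eh_star t) = psubst (env_subst g e) t.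
  rewrite psubst_upd_fresh ?psubst_eh_star //.
  by apply/negP=> /vars_eh_star/live_lt_start; rewrite ltnn.
have Ew : sigma eh_start = w0 by rewrite /sigma /upd eqxx.
rewrite -Ew; apply: (@psubst_rigid_language _ eh_grammar _ eh_rank (eh_start :: live cs)).
- exact: eh_rankP.
- exact: mem_head.
- rewrite Ew; case E: (vars w0) => [//|y ys]; have := mem_head y ys; rewrite -E.
  by case/vars_psubst=> z _; rewrite (env_subst_ground _ g0 ec).
move=> b; rewrite inE => /predU1P[->|bl].
  exists (eh_star u); rewrite sigma_star Ew; split=> //.
    by rewrite in_fset_seq !mem_cat map_f.
  by move=> y /vars_eh_star yl; rewrite inE yl orbT.
have [s bs Eb] := env_subst_live wf ec bl.
exists (eh_star s); rewrite sigma_star -Eb; split.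
- rewrite in_fset_seq !mem_cat; apply/orP; left; apply/orP; right.
  by apply/mapP; exists (b, s).
- by rewrite /sigma /upd ltn_eqF ?live_lt_start.
- by move=> y /vars_eh_star yl; rewrite inE yl orbT.
Qed.

Lemma rigid_eh_language w : rigid_language eh_grammar w -> w \in eh_language.
Proof.
case/(rigid_language_psubst eh_grammar_acyclic)=> rho [D [Ew _ DP]].
(* The heads of the padding lie above [eh_start], so the bound leaves only the productions that come
   from the sequent. *)
have {DP} DP b : b \in eh_start :: D -> b < eh_start.+1 -> exists s,
    [/\ (b, s) \in eh_prods, rho b = psubst rho s & {subset vars s <= D}].
  move=> /DP[s [bs Eb sD]] lt_b; exists s; split=> //.
  move: bs; rewrite in_fset_seq mem_cat => /orP[//|/paddingP[]].
  by rewrite ltnNge -ltnS lt_b.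
have [e ec eD] : exists2 e, e \in cut_envs g cs &
    forall b, b \in D -> b \in live cs -> env_subst g e b = rho b.
  apply: (@cut_envs_agree _ (mem (live cs))) => // b bD bl.
  have lt_b := live_lt_start bl.
  have [||s [bs Eb sD]] := DP b; [by rewrite inE bD orbT|by rewrite ltnW|].
  case/eh_prodsP: bs => [[u _ [Eb' _]]|[s' bs' Es]].
    by rewrite Eb' ltnn in lt_b.
  by rewrite Es in Eb sD; exists s'.
have [|//|s [bs Es sD]] := DP eh_start; first exact: mem_head.
case/eh_prodsP: bs => [[u uus [_ Eu]]|[s' /cut_prods_live/live_lt_start]]; last first.
  by rewrite ltnn.
apply/allpairsP; exists (e, u); split=> //=.
rewrite -Ew Es -(psubst_eh_star _ ec) -Eu; apply: eq_in_psubst => y ys.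
by apply/esym/eD; [exact: sD|apply: (@vars_eh_star u); rewrite -Eu].
Qed.

Lemma eh_forms_tautology x F : {subset fvars F <= [:: x]} ->
  tautology (eh_sequent x F (EhData us cs)) ->
  forms_tautology x F (rigid_language eh_grammar).
Proof.
move=> Fx taut; exists eh_language; split.
  by move=> t; split; [exact: eh_language_rigid|exact: rigid_eh_language].
move=> v; rewrite /= andbT implybF; apply/negP; rewrite eval_bigAnd all_map => /allP /= lang.
(* Under [e] all implications hold, and the instances of [F] in the sequent become instances over
   the language. *)
have [e ec e_all] := cut_envs_eval g v wf.
have := taut (vcomp v (env_subst g e)); rewrite /= all_cat e_all andbT implybF.
case/negP; rewrite all_map; apply/allP=> u uus /=; rewrite eval_vcomp_fsubst //.
by apply: lang; apply/allpairsP; exists (e, u).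
Qed.

End GrammarOfSequent.

Lemma grammar_of_extended_herbrand (L : language) (x : nat) (F : qf_formula L)
    (H : eh_data L) :
  (exists c : fun_sym L, fun_arity c = 0) -> {subset fvars F <= [:: x]} ->
  extended_herbrand x F H -> exists G : tree_grammar L,
    [/\ acyclic G, grammar_size G = eh_size H & forms_tautology x F (rigid_language G)].
Proof.
move=> [c c0] Fx /extended_herbrandP[]; case: H => us cs /= wf taut.
(* As [c] has arity 0 the argument function has empty domain: [Var 0] never occurs and [g] is
   ground. *)
pose g : term L := App c [ffun=> Var 0].
have g0 : vars g = [::].
  case E: (vars g) => [//|y ys]; have := mem_head y ys; rewrite -E => /in_vars_App[i _].
  by case: i => i; rewrite c0.
(* The sequent counts repeated terms, the set of productions merges them; [k] is the number lost. *)
pose k := eh_size (EhData us cs) - size (undup (eh_prods g us cs)).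
exists (eh_grammar us cs k g0); split; first exact: eh_grammar_acyclic.
  by rewrite eh_grammar_size subnKC // -(size_eh_prods g) size_undup.
exact: eh_forms_tautology.
Qed.

(** * From grammars to sequents *)

Section CanonicalCuts.
Variables (L : language) (x : nat) (F : qf_formula L) (S : nat -> seq (term L)).
Implicit Types (us : seq (term L)) (t u s : term L) (bs : seq nat).

Definition instances us : seq (qf_formula L) := [seq fsubst x u F | u <- us].

(** Terms without [a] are listed apart because they must survive when [S a] is empty, whereas terms
    that contain [a] then disappear. *)
Definition expand (a : nat) us : seq (term L) :=
  [seq u <- us | a \notin vars u] ++ [seq tsubst a s u | u <- us, s <- S a].

Fixpoint canonical_cuts us bs : seq (cut L) :=
  if bs is a :: bs' then
    Cut a (bigAnd (instances us)) (S a) :: canonical_cuts (expand a us) bs'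
  else [::].

Fixpoint full_expansion us bs : seq (term L) :=
  if bs is a :: bs' then full_expansion (expand a us) bs' else us.

Fixpoint ordered bs : Prop :=
  if bs is a :: bs' then
    (forall s, s \in S a -> {subset vars s <= bs'}) /\ ordered bs'
  else True.

Lemma cut_var_canonical us bs : map (@cut_var L) (canonical_cuts us bs) = bs.
Proof. by elim: bs us => //= a bs IH us; rewrite IH. Qed.

Lemma size_canonical us bs :
  \sum_(c <- canonical_cuts us bs) size (cut_terms c) = \sum_(a <- bs) size (S a).
Proof.
by elim: bs us => [|a bs IH] us; rewrite ?big_nil //= !big_cons IH.
Qed.

Lemma vars_tsubst a s u y :
  y \in vars (tsubst a s u) -> (y \in vars s) || (y \in vars u) && (y != a).
Proof.
rewrite tsubstE => /vars_psubst[z zu]; rewrite /upd; case: eqP => [_ -> //|/eqP za].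
by rewrite inE => /eqP ->; rewrite zu za orbT.
Qed.

Lemma expand_vars a us bs :
  (forall u, u \in us -> {subset vars u <= a :: bs}) ->
  (forall s, s \in S a -> {subset vars s <= bs}) ->
  forall u, u \in expand a us -> {subset vars u <= bs}.
Proof.
move=> us_sub S_sub u; rewrite mem_cat => /orP[|/allpairsP[[u1 s] /= [u1us sS ->]]].
  rewrite mem_filter => /andP[au uus] y yu; have := us_sub u uus y yu.
  by rewrite inE => /predU1P[ya|//]; rewrite -ya yu in au.
move=> y /vars_tsubst/orP[/(S_sub s sS) //|/andP[/(us_sub u1 u1us)]].
by rewrite inE => /orP[->|].
Qed.

Lemma fvars_instances us bs : {subset fvars F <= [:: x]} ->
  (forall u, u \in us -> {subset vars u <= bs}) ->
  {subset fvars (bigAnd (instances us)) <= bs}.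
Proof.
move=> Fx; elim: us => //= u us IH us_sub y; rewrite mem_cat => /orP[].
  case/fvars_fsubst/orP=> [/(us_sub u (mem_head _ _)) //|/andP[/Fx]].
  by rewrite inE => ->.
by apply: IH => u' u'us; apply: us_sub; rewrite inE u'us orbT.
Qed.

Lemma wf_canonical us bs : {subset fvars F <= [:: x]} -> uniq bs -> ordered bs ->
  (forall u, u \in us -> {subset vars u <= bs}) -> wf_cuts (canonical_cuts us bs).
Proof.
move=> Fx; elim: bs us => //= a bs IH us /andP[a_notin bs_uniq] [S_sub bs_ord] us_sub.
rewrite cut_var_canonical; split=> //; first exact: fvars_instances.
by apply: IH => //; apply: expand_vars.
Qed.

(** Modus ponens along the list: the conclusion of an implication gives the instances over the
    substituted terms, and together with the terms kept unchanged these form the next premise. *)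
Lemma eval_canonical v us bs : {subset fvars F <= [:: x]} ->
  all (eval v) (instances us) -> all (eval v) (map (@cut_imp L) (canonical_cuts us bs)) ->
  all (eval v) (instances (full_expansion us bs)).
Proof.
move=> Fx; elim: bs us => //= a bs IH us us_all; rewrite eval_bigAnd us_all /=.
case/andP=> concl; apply: IH; rewrite /instances map_cat all_cat.
apply/andP; split; rewrite all_map; apply/allP=> u.
  rewrite mem_filter => /andP[_ uus] /=.
  by move: us_all; rewrite all_map => /allP; apply.
case/allpairsP=> -[u1 s] /= [u1us sS ->].
move: concl; rewrite eval_bigAnd all_map => /allP/(_ s sS) /=.
rewrite -eval_vcomp_Var eval_fsubst psubst_Var eval_bigAnd all_map.
by move/allP/(_ u1 u1us); rewrite /= eval_vcomp_fsubst // -tsubstE.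
Qed.

(** Expanding [a] by the right-hand side that [sigma] respects does not change the image under
    [sigma]. After all of [bs] the term is ground, hence equal to that image. *)
Lemma full_expansion_psubst sigma (D : seq nat) u us bs :
  ordered bs ->
  (forall b, b \in D -> b \in bs -> exists s,
     [/\ s \in S b, sigma b = psubst sigma s & {subset vars s <= D}]) ->
  u \in us -> {subset vars u <= bs} -> {subset vars u <= D} ->
  psubst sigma u \in full_expansion us bs.
Proof.
elim: bs u us => [|a bs IH] u us /=.
  move=> _ _ uus u0 _; rewrite psubst_ground //.
  by case E: (vars u) u0 => [//|y ys] /(_ y (mem_head _ _)).
case=> S_sub bs_ord DP uus ubs uD.
have DP' b : b \in D -> b \in bs -> exists s,
     [/\ s \in S b, sigma b = psubst sigma s & {subset vars s <= D}].
  by move=> bD bbs; apply: DP; rewrite // inE bbs orbT.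
have [au|au] := boolP (a \in vars u); last first.
  apply: IH => //; first by rewrite mem_cat mem_filter au uus.
  move=> y yu; have := ubs y yu; rewrite inE => /predU1P[ya|//].
  by rewrite -ya yu in au.
have [s [sS Ea sD]] := DP a (uD a au) (mem_head _ _).
have -> : psubst sigma u = psubst sigma (tsubst a s u).
  by rewrite psubst_tsubst; apply: eq_in_psubst => y _; rewrite /upd; case: eqP => [->|].
apply: IH => //.
- by rewrite mem_cat; apply/orP; right; apply/allpairsP; exists (u, s).
- move=> y /vars_tsubst/orP[/(S_sub s sS) //|/andP[/ubs]].
  by rewrite inE => /orP[->|].
- by move=> y /vars_tsubst/orP[/sD //|/andP[/uD]].
Qed.

End CanonicalCuts.

(** * Topological order of the non-terminals of an acyclic grammar *)

Section SequentOfGrammar.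
Variables (L : language) (G : tree_grammar L).
Hypothesis acG : acyclic G.

Definition occurs_in_prod : rel (nonterms G) := fun b b' =>
  has (fun p => (p.1 == val b) && (val b' \in vars p.2)) (prods G).

Lemma derivation_edge t d b s y :
  derivation G t d -> b \in vars (last t d) -> (b, s) \in prods G -> y \in vars s ->
  exists d', [/\ 0 < size d', derivation G t d' & y \in vars (last t d')].
Proof.
move=> dd /var_position[p tp] bs ys; exists (rcons d (replace (last t d) p s)).
rewrite size_rcons last_rcons; split=> //; last first.
  exact: (subterm_vars (subterm_replace s tp)).
by apply: derivation_rcons => //; exists b, s, p.
Qed.

(** Links paths in the graph of productions with derivations, in terms of which acyclicity is
    stated. *)
Lemma connect_derivation b b' : connect occurs_in_prod b b' ->
  exists2 d, derivation G (Var (val b)) d & val b' \in vars (last (Var (val b)) d).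
Proof.
case/connectP=> p; elim/last_ind: p b' => [|p c IH] b'.
  by move=> _ ->; exists [::]; rewrite //= inE.
rewrite rcons_path last_rcons => /andP[/IH/(_ erefl)[d dd lastd]].
case/hasP=> -[b1 s] bs /= /andP[/eqP E cs] ->.
have {}lastd : b1 \in vars (last (Var (val b)) d) by rewrite E.
by have [d' [_ dd' cd']] := derivation_edge dd lastd bs cs; exists d'.
Qed.

Definition reach (y : nat) : nat :=
  if insub y is Some b then #|connect occurs_in_prod b| else 0.

(** All that [y] reaches is reached by [b], but [y] does not reach [b]: otherwise [y] would derive a
    term containing [y]. *)
Lemma reach_lt b s y : (b, s) \in prods G -> y \in vars s -> reach y < reach b.
Proof.
move=> bs ys; have [bN sN _] := prods_over bs; have yN := sN _ ys.
rewrite /reach !insubT; set b' := Sub b _; set y' := Sub y _.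
have by' : occurs_in_prod b' y' by apply/hasP; exists (b, s); rewrite //= eqxx ys.
apply/proper_card/properP; split.
  by apply/subsetP=> z; apply: connect_trans; apply: connect1.
exists b'; first exact: connect0.
apply/negP=> /connect_derivation[d dd bd].
have [d' [d'_gt0 dd' yd']] := derivation_edge dd bd bs ys.
by have := acG yN d'_gt0 dd'; rewrite yd'.
Qed.

Definition later : rel nat := fun a b => reach b <= reach a.

Definition topo : seq nat :=
  sort later [seq y <- nonterms G | y != start G].

(** In an acyclic grammar the start symbol never reappears in a derivation that begins with it, so
    right-hand sides that mention it add nothing to the language. The variables of the others all
    lie in [topo]. *)
Definition rhs (a : nat) : seq (term L) :=
  [seq p.2 | p <- prods G & (p.1 == a) && (start G \notin vars p.2)].

Lemma rhsP a s : reflect ((a, s) \in prods G /\ start G \notin vars s) (s \in rhs a).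
Proof.
apply: (iffP mapP) => [[[b s'] /= + ->]|[as_ s_start]].
  by rewrite mem_filter /= => /andP[/andP[/eqP -> ?] ?].
by exists (a, s); rewrite // mem_filter /= eqxx s_start.
Qed.

Lemma mem_topo y : (y \in topo) = (y != start G) && (y \in nonterms G).
Proof. by rewrite mem_sort mem_filter. Qed.

Lemma topo_ordered : ordered rhs topo.
Proof.
have later_tr : transitive later by move=> a b c ab bc; apply: leq_trans bc ab.
have : sorted later topo by apply: sort_sorted => a b; apply: leq_total.
(* Invariant for the induction on suffixes of [topo]: a non-terminal that has left the suffix has
   rank at least that of each remaining one, so it cannot occur in the right-hand sides of the
   latter. *)
have : forall y, y \in topo -> y \in topo \/ forall z, z \in topo -> reach z <= reach y.
  by left.
move: {2 3 4 5}topo; elim=> //= a bs IH cov.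
rewrite (path_sortedE later_tr) => /andP[/allP a_max bs_sorted]; split; last first.
  apply: IH => // y yN; case: (cov y yN) => [|y_max]; last first.
    by right=> z zbs; apply: y_max; rewrite inE zbs orbT.
  by rewrite inE => /predU1P[->|]; [right|left].
move=> s /rhsP[as_ s_start] y ys.
have yN : y \in topo.
  have [_ sN _] := prods_over as_.
  by rewrite mem_topo sN // andbT; apply: contraNneq s_start => <-.
have lt_ya := reach_lt as_ ys.
case: (cov y yN) => [|/(_ a (mem_head _ _))]; last by rewrite leqNgt lt_ya.
by rewrite inE => /predU1P[ya|//]; rewrite ya ltnn in lt_ya.
Qed.

Definition start_rhs : seq (term L) := [seq p.2 | p <- prods G & p.1 == start G].

Lemma start_rhsP s : reflect ((start G, s) \in prods G) (s \in start_rhs).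
Proof.
apply: (iffP mapP) => [[[b s'] /= + ->]|bs]; last first.
  by exists (start G, s); rewrite // mem_filter /= eqxx.
by rewrite mem_filter => /andP[/eqP /= <-].
Qed.

Lemma start_rhs_vars s : (start G, s) \in prods G -> {subset vars s <= topo}.
Proof.
move=> bs y ys; have [_ sN _] := prods_over bs; rewrite mem_topo sN // andbT.
by apply/eqP=> Ey; have := reach_lt bs ys; rewrite Ey ltnn.
Qed.

Lemma size_rhs : size start_rhs + \sum_(a <- topo) size (rhs a) <= #|` prods G|.
Proof.
have topo_uniq : uniq (start G :: topo).
  by rewrite /= mem_topo eqxx sort_uniq filter_uniq ?fset_uniq.
(* A production has a single head, so it is counted at most once over distinct heads. *)
have count_le (bs : seq nat) (ps : seq (nat * term L)) : uniq bs ->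
    \sum_(a <- bs) count (fun p => p.1 == a) ps <= size ps.
  move=> bs_uniq; elim: ps => [|p ps IH] /=; first by rewrite big1.
  rewrite big_split /= -add1n leq_add //.
  rewrite (_ : \sum_(a <- bs) _ = count_mem p.1 bs); last first.
    rewrite -sum1_count [RHS]big_mkcond; apply: eq_bigr => a _.
    by rewrite /= eq_sym; case: eqP.
  by rewrite (count_uniq_mem _ bs_uniq) leq_b1.
apply: leq_trans (count_le _ (prods G) topo_uniq); rewrite big_cons.
rewrite size_map size_filter leq_add2l; apply: leq_sum => a _.
by rewrite size_map size_filter; apply: sub_count => p /andP[].
Qed.

Lemma rigid_full_expansion w :
  rigid_language G w -> w \in full_expansion rhs start_rhs topo.
Proof.
case/(rigid_language_psubst acG)=> sigma [D [<- start_D DP]].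
have [s [ss -> sD]] := DP _ (mem_head _ _).
apply: full_expansion_psubst sD; [exact: topo_ordered| |exact/start_rhsP|].
  move=> b bD _; have [|s' [bs' Eb s'D]] := DP b; first by rewrite inE bD orbT.
  exists s'; split=> //; apply/rhsP; split=> //.
  by apply: contra start_D => /s'D.
exact: start_rhs_vars ss.
Qed.

End SequentOfGrammar.

Lemma extended_herbrand_pad (L : language) (x : nat) (F : qf_formula L) us cs us' :
  extended_herbrand x F (EhData us cs) -> extended_herbrand x F (EhData (us ++ us') cs).
Proof.
case=> cs_uniq cs_vars taut; split=> // v; have := taut v.
rewrite /= !implybF; apply: contra.
by rewrite map_cat !all_cat => /andP[/andP[-> _] ->].
Qed.

Lemma extended_herbrand_of_grammar (L : language) (x : nat) (F : qf_formula L)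
    (G : tree_grammar L) :
  {subset fvars F <= [:: x]} -> acyclic G -> forms_tautology x F (rigid_language G) ->
  exists H : eh_data L, extended_herbrand x F H /\ eh_size H = grammar_size G.
Proof.
move=> Fx acG [ts [tsP taut]].
pose us := start_rhs G; pose cs := canonical_cuts x F (rhs G) us (topo G).
have szE : eh_size (EhData us cs) = size us + \sum_(a <- topo G) size (rhs G a).
  by rewrite /eh_size /= size_canonical.
(* By [size_rhs] this difference is the exact loss in size. The term [Var 0] is arbitrary: extra
   instances of [F] keep the sequent valid. *)
pose pad : seq (term L) := nseq (grammar_size G - eh_size (EhData us cs)) (Var 0).
exists (EhData (us ++ pad) cs); split; last first.
  rewrite /eh_size /= size_cat size_nseq addnAC.
  by rewrite -[_ + \sum_(_ <- _) _]/(eh_size (EhData us cs)) subnKC // szE size_rhs.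
apply/extended_herbrand_pad/extended_herbrandP; split=> /=.
  apply: wf_canonical => //.
  - by rewrite sort_uniq filter_uniq ?fset_uniq.
  - exact: topo_ordered.
  - by move=> u /start_rhsP; apply: start_rhs_vars.
move=> v; rewrite /= implybF all_cat; apply/negP=> /andP[us_all cs_all].
have := eval_canonical Fx us_all cs_all; rewrite all_map => /allP full.
have := taut v; rewrite /= andbT implybF => /negP; apply.
rewrite eval_bigAnd all_map; apply/allP=> t /tsP tG /=.
by apply: full; apply: rigid_full_expansion.
Qed.

Theorem theorem5 (L : language) (hconst : exists c : fun_sym L, fun_arity c = 0)
  (x : nat) (F : qf_formula L) (hF : fvars F =i [:: x])
  (hunsat : forall_unsatisfiable x F) (l : nat) :
  (exists H : eh_data L, extended_herbrand x F H /\ eh_size H = l) <->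
  (exists G : tree_grammar L,
     [/\ acyclic G, grammar_size G = l & forms_tautology x F (rigid_language G)]).
Proof.
have Fx : {subset fvars F <= [:: x]} by move=> y; rewrite hF.
split=> [[H [HF <-]]|[G [acG <- taut]]].
  exact: grammar_of_extended_herbrand.
exact: extended_herbrand_of_grammar.
Qed.
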